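(* Suppose that $U \in \mathbb{DC}^{m\times m}$ and $V\in\mathbb{DC}^{n\times n}$ are unitary, and $A\in\mathbb{DC}^{m\times n}$. Then $$\|UAV\|_F=\|A\|_F .$$
   Context: Let $\epsilon\neq 0$ be the infinitesimal unit, $\epsilon^2=0$, commuting with complex numbers. Dual complex numbers: $\mathbb{DC}=\{q=q_{st}+q_{\mathcal I}\epsilon : q_{st},q_{\mathcal I}\in\mathbb C\}$ (a commutative ring); dual numbers: $\mathbb D=\{q_{st}+q_{\mathcal I}\epsilon: q_{st},q_{\mathcal I}\in\mathbb R\}$. The conjugate of $q$ is $\bar q=\bar q_{st}+\bar q_{\mathcal I}\epsilon$. For a matrix $A=(a_{ij})=A_{st}+A_{\mathcal I}\epsilon\in\mathbb{DC}^{m\times n}$ ($A_{st},A_{\mathcal I}$ complex matrices), $A^*=(\bar a_{ji})$. A square matrix $U\in\mathbb{DC}^{n\times n}$ is unitary if $U^*U=I_n$. For $q\in\mathbb D$ with $q_{st}>0$, $\sqrt q=\sqrt{q_{st}}+\frac{q_{\mathcal I}}{2\sqrt{q_{st}}}\epsilon$; also $\sqrt 0=0$. The magnitude of $q\in\mathbb{DC}$, with $q_{st}=q_1+q_2\mathbf i$, $q_{\mathcal I}=q_3+q_4\mathbf i$, is the dual number $|q|=\sqrt{q_1^2+q_2^2}+\frac{q_1q_3+q_2q_4}{\sqrt{q_1^2+q_2^2}}\epsilon$ if $q_{st}\ne0$, and $|q|=\sqrt{q_3^2+q_4^2}\,\epsilon$ if $q_{st}=0$. The Frobenius norm of $A\in\mathbb{DC}^{m\times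 n}$ is the dual number $\|A\|_F=\sqrt{\sum_{i,j}|a_{ij}|^2}$ if $A_{st}\neq O$, and $\|A\|_F=\|A_{\mathcal I}\|_F\,\epsilon$ (usual complex Frobenius norm of $A_{\mathcal I}$) if $A_{st}=O$. *)

(* Defs.v *)
From HB Require Import structures.
From mathcomp Require Import all_boot all_order all_algebra.
From mathcomp Require Import complex.

Set Implicit Arguments.
Unset Strict Implicit.
Unset Printing Implicit Defensive.

Import Order.TTheory GRing.Theory Num.Theory.

Local Open Scope ring_scope.

(* [Dual a b] stands for a + b * eps, where eps ^+ 2 = 0. *)
Record dual (T : Type) := Dual { dst : T; dinf : T }.

Section DualChoice.
Variable T : Type.

Definition pair_of_dual (q : dual T) : T * T := (dst q, dinf q).
Definition dual_of_pair (p : T * T) : dual T := Dual p.1 p.2.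

Lemma pair_of_dualK : cancel pair_of_dual dual_of_pair.
Proof. by case. Qed.

End DualChoice.

HB.instance Definition _ (T : eqType) :=
  Equality.copy (dual T) (can_type (@pair_of_dualK T)).
HB.instance Definition _ (T : choiceType) :=
  Choice.copy (dual T) (can_type (@pair_of_dualK T)).

Section DualRing.
Variable T : comNzRingType.
Implicit Types p q r : dual T.

Definition dual_zero : dual T := Dual 0 0.
Definition dual_one : dual T := Dual 1 0.
Definition dual_opp q : dual T := Dual (- dst q) (- dinf q).
Definition dual_add p q : dual T := Dual (dst p + dst q) (dinf p + dinf q).
Definition dual_mul p q : dual T :=
  Dual (dst p * dst q) (dst p * dinf q + dinf p * dst q).

Lemma dual_addA : associative dual_add.
Proof. by move=> p q r; rewrite /dual_add /= !addrA. Qed.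

Lemma dual_addC : commutative dual_add.
Proof. by move=> p q; congr Dual; rewrite addrC. Qed.

Lemma dual_add0 : left_id dual_zero dual_add.
Proof. by case=> a b; rewrite /dual_add /= !add0r. Qed.

Lemma dual_addN : left_inverse dual_zero dual_opp dual_add.
Proof. by move=> q; rewrite /dual_add /= !addNr. Qed.

HB.instance Definition _ := GRing.isZmodule.Build (dual T)
  dual_addA dual_addC dual_add0 dual_addN.

Lemma dual_mulA : associative dual_mul.
Proof.
by move=> p q r; rewrite /dual_mul /= mulrDr mulrDl !mulrA addrA.
Qed.

Lemma dual_mulC : commutative dual_mul.
Proof.
move=> p q; rewrite /dual_mul addrC; congr Dual; first exact: mulrC.
by congr (_ + _); exact: mulrC.
Qed.

Lemma dual_mul1 : left_id dual_one dual_mul.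
Proof. by case=> a b; rewrite /dual_mul /= !mul1r mul0r addr0. Qed.

Lemma dual_mulDl : left_distributive dual_mul dual_add.
Proof.
by move=> p q r; rewrite /dual_mul /dual_add /= !mulrDl addrACA.
Qed.

Lemma dual_one_neq0 : dual_one != 0 :> dual T.
Proof. by apply/eqP => -[/eqP]; rewrite oner_eq0. Qed.

HB.instance Definition _ := GRing.Zmodule_isComNzRing.Build (dual T)
  dual_mulA dual_mulC dual_mul1 dual_mulDl dual_one_neq0.

End DualRing.

Notation DC R := (dual (complex R)).

Section DualComplex.
Variable R : rcfType.

Definition dconj (q : DC R) : DC R := Dual (conjc (dst q)) (conjc (dinf q)).

Definition dadj m n (A : 'M[DC R]_(m, n)) : 'M[DC R]_(n, m) :=
  \matrix_(i, j) dconj (A j i).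

Definition dunitary n (U : 'M[DC R]_n) : Prop := dadj U *m U = 1%:M.

(* The square root is only meaningful when dst q > 0 or q = 0;
   the value 0 at the remaining arguments is a placeholder. *)
Definition dsqrt (q : dual R) : dual R :=
  if 0 < dst q then
    Dual (Num.sqrt (dst q)) (dinf q / (2 * Num.sqrt (dst q)))
  else 0.

Definition dabs (q : DC R) : dual R :=
  let: Complex q1 q2 := dst q in
  let: Complex q3 q4 := dinf q in
  if dst q != 0 then
    Dual (Num.sqrt (q1 ^+ 2 + q2 ^+ 2))
         ((q1 * q3 + q2 * q4) / Num.sqrt (q1 ^+ 2 + q2 ^+ 2))
  else Dual 0 (Num.sqrt (q3 ^+ 2 + q4 ^+ 2)).

Definition cfrob m n (B : 'M[complex R]_(m, n)) : R :=
  Num.sqrt (\sum_(i < m) \sum_(j < n) ComplexField.Normc.normc (B i j) ^+ 2).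

(* In the first case the sum has a positive standard part, so [dsqrt] is
   never used outside its domain. *)
Definition dfrob m n (A : 'M[DC R]_(m, n)) : dual R :=
  if map_mx (@dst _) A != 0 then
    dsqrt (\sum_(i < m) \sum_(j < n) dabs (A i j) ^+ 2)
  else Dual 0 (cfrob (map_mx (@dinf _) A)).

End DualComplex.

(* Main.v *)
Require Import Defs.
From HB Require Import structures.
From mathcomp Require Import all_boot all_order all_algebra.
From mathcomp Require Import complex reals.
From mathcomp Require Import ring.

Import Order.TTheory GRing.Theory Num.Theory.

Local Open Scope ring_scope.

(** For every dual complex number [q] one has [|q|^2 = conj q * q]; when the
    standard part of [q] vanishes both sides are [0] because [eps^2 = 0].
    Hence the sum [S(A)] of the squared magnitudes of the entries of [A],
    viewed as a dual complex number, is the trace of [A' A], where [A'] is the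
    conjugate transpose of [A], and
    [tr (V' A' U' U A V) = tr (A' A V V') = tr (A' A)] because a one-sided
    inverse of a square matrix over a commutative ring is two-sided
    ([dsqnorm_unitary]).

    The standard part of a product is the product of the standard parts and
    [A = U' (U A V) V'], so the standard part of [U A V] vanishes exactly when
    that of [A] does ([dst_unitary_eq0]).  If they do not vanish, the norms are
    the square roots of [S(U A V)] and [S(A)].  If they vanish, [A = B eps]
    with [B] a complex matrix and [U A V = (U_st B V_st) eps]; regarding [B] as
    a dual complex matrix, the standard part of [S(U B V) = S(B)] says that
    [U_st B V_st] and [B] have the same complex Frobenius norm
    ([cfrob_dinf_unitary]). *)

Section DualParts.

Set Implicit Arguments.
Unset Strict Implicit.

Variable T : comNzRingType.

Lemma dst_is_zmod_morphism : zmod_morphism (@dst T). Proof. by []. Qed.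
Lemma dst_is_monoid_morphism : monoid_morphism (@dst T). Proof. by []. Qed.
Lemma dinf_is_zmod_morphism : zmod_morphism (@dinf T). Proof. by []. Qed.

HB.instance Definition _ :=
  GRing.isZmodMorphism.Build (dual T) T (@dst T) dst_is_zmod_morphism.
HB.instance Definition _ :=
  GRing.isMonoidMorphism.Build (dual T) T (@dst T) dst_is_monoid_morphism.
HB.instance Definition _ :=
  GRing.isZmodMorphism.Build (dual T) T (@dinf T) dinf_is_zmod_morphism.

Lemma map_dinf_mulmx m n p (A : 'M[dual T]_(m, n)) (B : 'M[dual T]_(n, p)) :
  map_mx (@dinf T) (A *m B) =
    map_mx (@dst T) A *m map_mx (@dinf T) B
    + map_mx (@dinf T) A *m map_mx (@dst T) B.
Proof.
apply/matrixP => i j; rewrite !mxE raddf_sum -big_split.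
by apply: eq_bigr => k _; rewrite !mxE.
Qed.

End DualParts.

Section DualFrobenius.

Set Implicit Arguments.
Unset Strict Implicit.

Variable R : rcfType.

(** The inclusion of the dual numbers into the dual complex numbers. *)
Definition dual_real (q : dual R) : DC R :=
  Dual (Complex (dst q) 0) (Complex (dinf q) 0).

Lemma dual_real_inj : injective dual_real.
Proof. by case=> a b [c d] [-> ->]. Qed.

Lemma dual_real_is_zmod_morphism : zmod_morphism dual_real.
Proof.
by case=> a b [c d]; congr Dual; apply/eqP; rewrite eq_complex /= subr0 !eqxx.
Qed.

HB.instance Definition _ :=
  GRing.isZmodMorphism.Build (dual R) (DC R) dual_real
    dual_real_is_zmod_morphism.

Lemma dconjM (p q : DC R) : dconj (p * q) = dconj p * dconj q.
Proof. by rewrite /dconj /= rmorphD !rmorphM. Qed.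

Lemma dconj_is_zmod_morphism : zmod_morphism (@dconj R).
Proof. by move=> p q; rewrite /dconj /= !rmorphB. Qed.

HB.instance Definition _ :=
  GRing.isZmodMorphism.Build (DC R) (DC R) (@dconj R) dconj_is_zmod_morphism.

Lemma dadjM m n p (A : 'M[DC R]_(m, n)) (B : 'M[DC R]_(n, p)) :
  dadj (A *m B) = dadj B *m dadj A.
Proof.
apply/matrixP => i j; rewrite !mxE raddf_sum.
by apply: eq_bigr => k _; rewrite !mxE /= dconjM mulrC.
Qed.

Lemma dual_real_dabs_sqr (q : DC R) :
  dual_real (dabs q ^+ 2) = dconj q * q.
Proof.
case: q => [[a b] [c d]]; rewrite /dabs /=.
case: ifPn => [q0 | /negPn/eqP [-> ->]].
  have sq_ge0 : 0 <= a ^+ 2 + b ^+ 2 by rewrite addr_ge0 ?sqr_ge0.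
  have s0 : Num.sqrt (a ^+ 2 + b ^+ 2) != 0.
    rewrite sqrtr_eq0 -ltNge lt_neqAle sq_ge0 andbT eq_sym.
    rewrite paddr_eq0 ?sqr_ge0 // !sqrf_eq0.
    by apply: contra q0; rewrite eq_complex.
  have sE := sqr_sqrtr sq_ge0; move: s0 sE.
  set s := Num.sqrt _ => s0 sE.
  rewrite /dual_real expr2 /= -expr2 sE.
  congr Dual; apply/eqP; rewrite eq_complex /=; apply/andP; split; apply/eqP;
    by [field | ring].
rewrite /dual_real expr2 /=.
by congr Dual; apply/eqP; rewrite eq_complex /=; apply/andP; split; apply/eqP;
  ring.
Qed.

(** The sum of the squared magnitudes of the entries. *)
Definition dsqnorm m n (A : 'M[DC R]_(m, n)) : dual R :=
  \sum_(i < m) \sum_(j < n) dabs (A i j) ^+ 2.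

Lemma dual_real_dsqnorm m n (A : 'M[DC R]_(m, n)) :
  dual_real (dsqnorm A) = \tr (dadj A *m A).
Proof.
rewrite /dsqnorm exchange_big raddf_sum; apply: eq_bigr => j _.
rewrite mxE raddf_sum; apply: eq_bigr => i _.
by rewrite !mxE; exact: dual_real_dabs_sqr.
Qed.

Lemma dunitaryC n (U : 'M[DC R]_n) : dunitary U -> U *m dadj U = 1%:M.
Proof. exact: mulmx1C. Qed.

Lemma dsqnorm_unitary m n (U : 'M[DC R]_m) (V : 'M[DC R]_n)
    (A : 'M[DC R]_(m, n)) :
  dunitary U -> dunitary V -> dsqnorm (U *m A *m V) = dsqnorm A.
Proof.
move=> hU hV; apply: dual_real_inj; rewrite !dual_real_dsqnorm !dadjM.
rewrite -mulmxA mxtrace_mulC -!mulmxA (dunitaryC hV) mulmx1.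
by rewrite [dadj U *m _]mulmxA hU mul1mx.
Qed.

Lemma dst_dabs (q : DC R) :
  dst (dabs q) = ComplexField.Normc.normc (dst q).
Proof.
case: q => [[a b] [c d]]; rewrite /dabs /=.
by case: ifPn => // /negPn/eqP [-> ->]; rewrite /= expr0n addr0 sqrtr0.
Qed.

Lemma cfrob_dst m n (A : 'M[DC R]_(m, n)) :
  cfrob (map_mx (@dst _) A) = Num.sqrt (dst (dsqnorm A)).
Proof.
rewrite /cfrob /dsqnorm raddf_sum; congr Num.sqrt; apply: eq_bigr => i _.
by rewrite raddf_sum; apply: eq_bigr => j _; rewrite mxE -dst_dabs [RHS]rmorphXn.
Qed.

Lemma dst_unitary_eq0 m n (U : 'M[DC R]_m) (V : 'M[DC R]_n)
    (A : 'M[DC R]_(m, n)) :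
  dunitary U -> dunitary V ->
  (map_mx (@dst _) (U *m A *m V) == 0) = (map_mx (@dst _) A == 0).
Proof.
move=> hU hV; apply/eqP/eqP => [A0 | A0]; last first.
  by rewrite !map_mxM /= A0 mulmx0 mul0mx.
have -> : A = dadj U *m (U *m A *m V) *m dadj V.
  by rewrite -!mulmxA (dunitaryC hV) mulmx1 mulmxA hU mul1mx.
by rewrite [LHS]map_mxM map_mxM /= A0 mulmx0 mul0mx.
Qed.

Lemma cfrob_dinf_unitary m n (U : 'M[DC R]_m) (V : 'M[DC R]_n)
    (A : 'M[DC R]_(m, n)) :
  dunitary U -> dunitary V -> map_mx (@dst _) A = 0 ->
  cfrob (map_mx (@dinf _) (U *m A *m V)) = cfrob (map_mx (@dinf _) A).
Proof.
move=> hU hV A0.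
(* The infinitesimal part of A, regarded as a standard part. *)
pose B : 'M[DC R]_(m, n) := \matrix_(i, j) Dual (dinf (A i j)) 0.
have BE : map_mx (@dinf _) A = map_mx (@dst _) B.
  by apply/matrixP => i j; rewrite !mxE.
have -> : map_mx (@dinf _) (U *m A *m V) = map_mx (@dst _) (U *m B *m V).
  rewrite !map_dinf_mulmx !map_mxM /= A0 BE.
  by rewrite !mulmx0 mul0mx add0r addr0.
by rewrite BE !cfrob_dst dsqnorm_unitary.
Qed.

End DualFrobenius.

Theorem theorem3p7 (R : realType) (m n : nat)
    (U : 'M[DC R]_m) (V : 'M[DC R]_n) (A : 'M[DC R]_(m, n))
    (hU : dunitary U) (hV : dunitary V) :
  dfrob (U *m A *m V) = dfrob A.
Proof.
rewrite /dfrob dst_unitary_eq0 //; case: ifPn => [_ | /negPn/eqP A0].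
  by congr dsqrt; exact: dsqnorm_unitary.
by rewrite cfrob_dinf_unitary.
Qed.
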